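(* Let $N\ge1$, let $a_1>a_2>a_3$ be real numbers, let $p_i,c_i,c'_i$ ($1\le i\le N$) be arbitrary real numbers and $s$ a fixed integer. For integers $l,m,n,s$ put $\eta_i(l,m,n,s)=p_is+\max(0,p_i-a_1)l+\max(0,p_i-a_2)m+\max(0,p_i-a_3)n+c_i$, $\eta'_i(l,m,n,s)=-p_is+\max(0,-p_i-a_1)l+\max(0,-p_i-a_2)m+\max(0,-p_i-a_3)n+c'_i$, $\phi_i(l,m,n,s)=\max(\eta_i(l,m,n,s),\eta'_i(l,m,n,s))$, and $\tau(l,m,n)=\max[\phi_i(l,m,n,s+j-1)]_{1\le i,j\le N}$. Then $\tau$ satisfies the ultradiscrete KP equation \[ \tau(l,m+1,n)+\tau(l+1,m,n+1)-a_2=\max\bigl(\tau(l+1,m,n)+\tau(l,m+1,n+1)-a_1,\ \tau(l,m,n+1)+\tau(l+1,m+1,n)-a_2\bigr) \] for all integers $l,m,n$.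
   Context: Ultradiscrete permanent (UP): for a real $N\times N$ matrix $A=(a_{ij})$, $\max[a_{ij}]_{1\le i,j\le N}\equiv\max_{\pi}\sum_{i=1}^N a_{i\pi(i)}$, the maximum over all permutations $\pi$ of $\{1,\dots,N\}$. *)

(* Defs.v *)
From HB Require Import structures.
From mathcomp Require Import all_boot all_order all_algebra all_fingroup.
From mathcomp Require Import reals.
Set Implicit Arguments. Unset Strict Implicit. Unset Printing Implicit Defensive.
Import Order.TTheory GRing.Theory Num.Theory.
Local Open Scope ring_scope.

(* Ultradiscrete permanent: max over all permutations pi of sum_i A i (pi i).
   The fold starts from the identity-permutation sum, which is itself one of
   the terms, so this is exactly the maximum over 'S_N (for any N). *)
Definition UP (R : realDomainType) (N : nat) (A : 'I_N -> 'I_N -> R) : R :=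
  \big[Num.max/ (\sum_(i < N) A i i)]_(pi : 'S_N) \sum_(i < N) A i (pi i).

Definition eta (R : realDomainType) (a1 a2 a3 p c : R) (l m n s : int) : R :=
  p * s%:~R + Num.max 0 (p - a1) * l%:~R + Num.max 0 (p - a2) * m%:~R
  + Num.max 0 (p - a3) * n%:~R + c.

Definition eta' (R : realDomainType) (a1 a2 a3 p c' : R) (l m n s : int) : R :=
  - p * s%:~R + Num.max 0 (- p - a1) * l%:~R + Num.max 0 (- p - a2) * m%:~R
  + Num.max 0 (- p - a3) * n%:~R + c'.

Definition phi (R : realDomainType) (a1 a2 a3 p c c' : R) (l m n s : int) : R :=
  Num.max (eta a1 a2 a3 p c l m n s) (eta' a1 a2 a3 p c' l m n s).

(* tau(l,m,n) = UP[ phi_i(l,m,n,s+j-1) ]_{1<=i,j<=N}; with 0-based j : 'I_N,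
   s + j - 1 (1-based) becomes s + j. *)
Definition tau (R : realDomainType) (N : nat) (a1 a2 a3 : R)
    (p c c' : 'I_N -> R) (s : int) (l m n : int) : R :=
  UP (fun i j : 'I_N => phi a1 a2 a3 (p i) (c i) (c' i) l m n (s + (j : nat)%:Z)).

(* Main.v *)
Require Import Defs.
From HB Require Import structures.
From mathcomp Require Import all_boot all_order all_algebra all_fingroup.
From mathcomp Require Import reals.
From mathcomp Require Import sequences exp ring lra.
Import Order.TTheory GRing.Theory Num.Theory.
Local Open Scope ring_scope.
Set Implicit Arguments. Unset Strict Implicit. Unset Printing Implicit Defensive.

(* The ultradiscrete identity is the limit of a subtraction-free classical one.
   One may assume 0 <= p_1 <= ... <= p_N: the entries are invariant under
   (p, c, c') -> (- p, c', c), and UP under row permutations. Put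
   Q_i = g_i e^(n p_i), alpha_k = h_k e^(n a_k) with fixed distinct g_i > 1 and
   h_k, and f_i(j) = C_i Q_i^j + (-1)^i C'_i Q_i^(-j). The determinant with rows
   f_1, ..., f_N, (- alpha_k)^j, (- alpha_l)^j factors as
   (alpha_k - alpha_l) E_kl, where E_kl, a signed sum of Vandermonde
   determinants, has only positive terms and grows like e^(n T_kl), T_kl being
   the tau function shifted in the directions k and l up to a constant.
   Comparing exponential rates in n on both sides of the three-term Pluecker
   relation
     (alpha_0 - alpha_1)(alpha_2 - alpha_3) E_01 E_23
     + (alpha_0 - alpha_3)(alpha_1 - alpha_2) E_03 E_12
     = (alpha_0 - alpha_2)(alpha_1 - alpha_3) E_02 E_13,
   whose factors are all positive, gives the claim. *)

(** * Determinants: Plücker relation and Vandermonde expansion *)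

Lemma det_mx2 (K : comNzRingType) (M : 'M[K]_2) :
  \det M = M 0 0 * M 1 1 - M 0 1 * M 1 0.
Proof.
rewrite (expand_det_row _ 0) big_ord_recl big_ord1 /cofactor !det_mx11 !mxE.
have -> : lift ord0 0 = 1 :> 'I_2 by exact: val_inj.
have -> : lift 1 0 = 0 :> 'I_2 by exact: val_inj.
by rewrite /= expr0 mul1r expr1 mulN1r mulrN.
Qed.

(* If F has full row rank, a column change turns F into [I 0], so that each
   determinant becomes the same multiple of a 2 x 2 minor; otherwise all of
   them vanish. *)
Lemma det_plucker (K : fieldType) (N : nat) (F : 'M[K]_(N, N + 2))
    (v : 'I_4 -> 'rV[K]_(N + 2)) :
  let D a b : K := \det (col_mx F (col_mx (v a) (v b) : 'M_(2, N + 2))) in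
  D 0 1 * D 2 3 - D 0 2 * D 1 3 + D 0 3 * D 1 2 = 0.
Proof.
move=> D.
have [Ffull | Fdep] := boolP (row_free F); last first.
  suff D0 a b : D a b = 0 by rewrite !D0; ring.
  move: Fdep; rewrite -kermx_eq0 => /rowV0Pn [u /sub_kermxP uF u0].
  apply/eqP/det0P; exists (row_mx u 0).
    by apply: contra_neq u0; rewrite -row_mx0 => /eq_row_mx [].
  by rewrite mul_row_col uF mul0mx addr0.
pose U := row_ebase F; pose L := col_ebase F.
have rF : \rank F = N by apply/eqP.
have defF : F = row_mx L 0 *m U.
  by rewrite -[LHS]mulmx_ebase rF pid_mx_row mul_mx_row mulmx1 mulmx0.
(* In the coordinates given by [U] the matrix is block triangular, so only the last two coordinates
   of [v a] matter. *)
pose w a : 'rV[K]_2 := rsubmx (v a *m invmx U).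
pose m a b : K := w a 0 0 * w b 0 1 - w a 0 1 * w b 0 0.
have DE a b : D a b = \det L * \det U * m a b.
  have -> : D a b = \det (block_mx L 0 (lsubmx (col_mx (v a) (v b) *m invmx U))
                            (col_mx (w a) (w b)) *m U).
    congr (\det _); rewrite /block_mx mul_col_mx -defF; congr col_mx.
    have -> : (col_mx (w a) (w b) : 'M_2) =
              rsubmx (col_mx (v a) (v b) *m invmx U).
      rewrite mul_col_mx; apply/matrixP=> i j; rewrite !mxE.
      by case: split => k; rewrite !mxE.
    by rewrite hsubmxK mulmxKV // row_ebase_unit.
  rewrite det_mulmx det_lblock mulrAC; congr (_ * _).
  have r0 j : col_mx (w a) (w b) 0 j = w a 0 j.
    rewrite -[RHS](col_mxEu (w a) (w b)).
    by congr (fun_of_matrix _ _ _); apply: val_inj.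
  have r1 j : col_mx (w a) (w b) 1 j = w b 0 j.
    rewrite -[RHS](col_mxEd (w a) (w b)).
    by congr (fun_of_matrix _ _ _); apply: val_inj.
  by rewrite det_mx2 !r0 !r1.
rewrite !DE /m; ring.
Qed.

(** Multilinearity in the first [N] rows, applied to all of them at once: in the Leibniz formula it
    is distributivity of a product over sums. *)
Lemma det_sum_rows (K : comNzRingType) (N k : nat) (C : 'I_N -> bool -> K)
    (G : 'I_N -> bool -> 'I_(N + k) -> K) (X : 'M[K]_(k, N + k)) :
  \det (col_mx (\matrix_(i, j) \sum_b C i b * G i b j) X) =
  \sum_(e : {ffun 'I_N -> bool})
    (\prod_i C i (e i)) * \det (col_mx (\matrix_(i, j) G i (e i) j) X).
Proof.
pose rX (s : 'S_(N + k)) := \prod_i X i (s (rshift N i)).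
have detE (M : 'M_(N, N + k)) : \det (col_mx M X) =
    \sum_(s : 'S_(N + k)) (-1) ^+ s * ((\prod_i M i (s (lshift k i))) * rX s).
  apply: eq_bigr => s _; rewrite big_split_ord; congr (_ * (_ * _)).
    by apply: eq_bigr => i _; rewrite col_mxEu.
  by apply: eq_bigr => i _; rewrite col_mxEd.
rewrite detE (eq_bigr _ (fun e _ => congr1 _ (detE _))).
under [RHS]eq_bigr do rewrite mulr_sumr.
rewrite exchange_big; apply: eq_bigr => s _ /=.
under eq_bigr do rewrite mxE.
rewrite bigA_distr_bigA mulr_suml mulr_sumr; apply: eq_bigr => e _.
rewrite big_split /=; under [X in _ = _ * (_ * (X * _))]eq_bigr do rewrite mxE.
by rewrite -mulrA mulrCA.
Qed.

(** Separates, in a Vandermonde product, the pairs involving the last two nodes. *)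
Lemma big_ltn_split2 (K : comNzRingType) (N : nat)
    (F : 'I_(N + 2) -> 'I_(N + 2) -> K) :
  \prod_(i < N + 2) \prod_(j < N + 2 | (i < j)%N) F i j =
  (\prod_(i < N) \prod_(j < N | (i < j)%N) F (lshift 2 i) (lshift 2 j)) *
  (\prod_(i < N) (F (lshift 2 i) (rshift N 0) * F (lshift 2 i) (rshift N 1))) *
  F (rshift N 0) (rshift N 1).
Proof.
have e1 : lift ord0 0 = 1 :> 'I_2 by exact: val_inj.
rewrite big_split_ord -big_split /=; congr (_ * _).
  apply: eq_bigr => i _; rewrite big_split_ord /=; congr (_ * _).
  rewrite (eq_bigl xpredT) => [|k]; last by rewrite (leq_trans (ltn_ord i)) ?leq_addr.
  by rewrite big_ord_recl big_ord1 e1.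
have low (k : 'I_2) : \prod_(j < N + 2 | (N + k < j)%N) F (rshift N k) j =
    \prod_(j < 2 | (k < j)%N) F (rshift N k) (rshift N j).
  rewrite big_split_ord /= big_pred0 => [|j]; last first.
    by apply/negbTE; rewrite -leqNgt (leq_trans (ltnW (ltn_ord j))) ?leq_addr.
  by rewrite mul1r; apply: eq_bigl => j; rewrite ltn_add2l.
under eq_bigr do rewrite low.
rewrite big_ord_recl big_ord1 e1 [X in _ * X]big_pred0 => [|j]; last first.
  by apply/negbTE; rewrite -leqNgt -ltnS.
by rewrite mulr1 big_mkcond big_ord_recl big_ord1 e1 /= mul1r.
Qed.

Definition pow_row (K : nzRingType) (n : nat) (x : K) : 'rV[K]_n := \row_j x ^+ j.

Lemma det_powers (K : comNzRingType) (N : nat) (Q : 'I_N -> K) (x y : K) :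
  \det (col_mx (\matrix_(i, j) Q i ^+ (j : 'I_(N + 2)))
               (col_mx (pow_row (N + 2) x) (pow_row (N + 2) y) : 'M_(2, N + 2))) =
  (\prod_(j < N) \prod_(i < N | (i < j)%N) (Q j - Q i)) *
  (\prod_(i < N) ((x - Q i) * (y - Q i))) * (y - x).
Proof.
pose z : 'rV[K]_(N + 2) :=
  row_mx (\row_i Q i) (\row_(k < 2) if k == 0 then x else y).
rewrite -det_tr.
have -> : (col_mx (\matrix_(i, j) Q i ^+ (j : 'I_(N + 2)))
    (col_mx (pow_row (N + 2) x) (pow_row (N + 2) y) : 'M_(2, N + 2)))^T =
    Vandermonde (N + 2) z.
  apply/matrixP => j i; rewrite !mxE; case: split => k; rewrite !mxE //.
  by case: splitP => k'; rewrite ord1 -val_eqE /= => ->; rewrite mxE.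
rewrite det_Vandermonde big_ltn_split2.
have zl i : z 0 (lshift 2 i) = Q i by rewrite row_mxEl mxE.
rewrite !row_mxEr !mxE /=.
under eq_bigr do under eq_bigr do rewrite !zl.
under [X in _ * X * _]eq_bigr do rewrite !zl.
by rewrite (exchange_big_dep xpredT).
Qed.

(** * Exponential growth rates *)

Definition dominated (R : realType) (f g : nat -> R) : Prop :=
  exists2 K : R, 0 < K & forall n, f n <= K * g n.

(** This is f = Θ(e^(n x)) with constants valid for every n, not only for large n; hence f is
    positive everywhere. *)
Definition growth (R : realType) (f : nat -> R) (x : R) : Prop :=
  dominated f (fun n => expR (n%:R * x)) /\ dominated (fun n => expR (n%:R * x)) f.

Section Growth.
Variable R : realType.
Implicit Types (f g h : nat -> R) (x y c d : R).

Lemma le_dominated f g : (forall n, f n <= g n) -> dominated f g.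
Proof. by move=> fg; exists 1 => // n; rewrite mul1r. Qed.

Lemma dominated_trans f g h : dominated f g -> dominated g h -> dominated f h.
Proof.
move=> [K K0 fg] [L L0 gh]; exists (K * L) => [|n]; first exact: mulr_gt0.
by rewrite (le_trans (fg n)) // -mulrA ler_pM2l.
Qed.

Lemma dominated_mul f g h k : (forall n, 0 <= f n) -> (forall n, 0 <= g n) ->
  dominated f h -> dominated g k ->
  dominated (fun n => f n * g n) (fun n => h n * k n).
Proof.
move=> f0 g0 [K K0 fh] [L L0 gk]; exists (K * L) => [|n]; first exact: mulr_gt0.
by rewrite mulrACA ler_pM.
Qed.

Lemma dominated_sum (I : finType) (F : I -> nat -> R) g : (forall n, 0 <= g n) ->
  (forall i, dominated (F i) g) -> dominated (fun n => \sum_i F i n) g.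
Proof.
move=> g0 Fg.
have {}Fg i : exists K, 0 < K /\ forall n, F i n <= K * g n.
  by have [K ? ?] := Fg i; exists K.
have [K KP] := boolp.choice Fg.
exists (1 + \sum_i K i) => [|n].
  by rewrite ltr_wpDr // sumr_ge0 // => i _; have [/ltW] := KP i.
rewrite mulrDl mul1r mulr_suml ler_wpDl // ler_sum // => i _.
by have [_] := KP i.
Qed.

Lemma dominated_expR x y : x <= y ->
  dominated (fun n => expR (n%:R * x)) (fun n => expR (n%:R * y)).
Proof. by move=> xy; apply: le_dominated => n; rewrite ler_expR ler_wpM2l. Qed.

Lemma dominated_expR_le x y :
  dominated (fun n => expR (n%:R * x)) (fun n => expR (n%:R * y)) -> x <= y.
Proof.
move=> [K K0 xy]; rewrite leNgt; apply/negP => yx.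
have xy0 : 0 < x - y by rewrite subr_gt0.
(* This n exceeds K / (x - y), which contradicts 1 + n (x - y) <= e^(n (x - y)) <= K. *)
pose n := Num.bound (K / (x - y)).
have : 1 + n%:R * (x - y) <= K.
  apply: le_trans (expR_ge1Dx _) _.
  by rewrite mulrBr expRD expRN ler_pdivrMr ?expR_gt0.
have := archi_boundP (ltW (divr_gt0 K0 xy0)).
by rewrite -/n ltr_pdivrMr //; lra.
Qed.

Lemma growth_gt0 f x n : growth f x -> 0 < f n.
Proof.
move=> [_ [K K0 /(_ n) fx]]; rewrite -(pmulr_rgt0 _ K0).
exact: lt_le_trans (expR_gt0 _) fx.
Qed.

Lemma eq_growth f g x : f =1 g -> growth f x -> growth g x.
Proof. by move=> /boolp.funext <-. Qed.

(** Uniqueness of the rate turns an identity of sequences into an identity of rates. *)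
Lemma growth_inj f x y : growth f x -> growth f y -> x = y.
Proof.
move=> [fx xf] [fy yf]; apply/eqP; rewrite eq_le.
by rewrite !dominated_expR_le //; apply: dominated_trans; eassumption.
Qed.

Lemma growth_scale c x : 0 < c -> growth (fun n => c * expR (n%:R * x)) x.
Proof.
move=> c0; split; first by exists c.
by exists c^-1 => [|n]; rewrite ?invr_gt0 // mulKf ?gt_eqF.
Qed.

Lemma growth_mul f g x y : growth f x -> growth g y ->
  growth (fun n => f n * g n) (x + y).
Proof.
move=> fx gy; have f0 n := ltW (growth_gt0 n fx); have g0 n := ltW (growth_gt0 n gy).
have e0 z n : 0 <= expR (n%:R * z) :> R by exact: expR_ge0.
case: fx gy => [fx xf] [gy yg]; rewrite /growth.
have -> : (fun n => expR (n%:R * (x + y))) =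
    (fun n => expR (n%:R * x) * expR (n%:R * y)) :> (nat -> R).
  by apply/boolp.funext => n; rewrite mulrDr expRD.
by split; apply: dominated_mul.
Qed.

(** Both sequences are positive, so nothing cancels and the larger rate wins. *)
Lemma growth_add f g x y : growth f x -> growth g y ->
  growth (fun n => f n + g n) (Num.max x y).
Proof.
move=> fx gy; have f0 n := ltW (growth_gt0 n fx); have g0 n := ltW (growth_gt0 n gy).
case: fx gy => [fx xf] [gy yg]; split.
  have [K K0 fK] : dominated f (fun n => expR (n%:R * Num.max x y)).
    by apply: dominated_trans fx (dominated_expR _); rewrite le_max lexx.
  have [L L0 gL] : dominated g (fun n => expR (n%:R * Num.max x y)).
    by apply: dominated_trans gy (dominated_expR _); rewrite le_max lexx orbT.
  by exists (K + L) => [|n]; rewrite ?addr_gt0 // mulrDl lerD.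
rewrite maxEle; case: ifP => _.
  by apply: dominated_trans yg (le_dominated _) => n; rewrite lerDr.
by apply: dominated_trans xf (le_dominated _) => n; rewrite lerDl.
Qed.

(** The gap [d < c] leaves at least (c - d) e^(n x), even when x = y. *)
Lemma growth_sub c d x y : 0 <= d -> d < c -> y <= x ->
  growth (fun n => c * expR (n%:R * x) - d * expR (n%:R * y)) x.
Proof.
move=> d0 dc yx; split.
  exists c => [|n]; first exact: le_lt_trans dc.
  by rewrite gerBl mulr_ge0 ?expR_ge0.
exists (c - d)^-1 => [|n]; first by rewrite invr_gt0 subr_gt0.
rewrite ler_pdivlMl ?subr_gt0 // mulrBl.
by rewrite lerD2l lerN2 ler_wpM2l // ler_expR ler_wpM2l.
Qed.

Lemma growth_prod (I : Type) (r : seq I) (P : pred I) (F : I -> nat -> R) (x : I -> R) :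
  (forall i, P i -> growth (F i) (x i)) ->
  growth (fun n => \prod_(i <- r | P i) F i n) (\sum_(i <- r | P i) x i).
Proof.
move=> Fx; elim: r => [|i r IHr].
  rewrite big_nil; apply: eq_growth (growth_scale _ ltr01) => n.
  by rewrite big_nil mulr0 expR0 mulr1.
rewrite big_cons; case: ifPn => Pi.
  by apply: eq_growth (growth_mul (Fx i Pi) IHr) => n; rewrite big_cons Pi.
by apply: eq_growth IHr => n; rewrite big_cons (negPf Pi).
Qed.

End Growth.

(** * The ultradiscrete permanent *)

Lemma UP_ge (R : realDomainType) (N : nat) (A : 'I_N -> 'I_N -> R) (s : 'S_N) :
  \sum_i A i (s i) <= UP A.
Proof. exact: (le_bigmax _ (fun s : 'S_N => \sum_i A i (s i))). Qed.

Lemma UP_attained (R : realDomainType) (N : nat) (A : 'I_N -> 'I_N -> R) :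
  exists s : 'S_N, UP A = \sum_i A i (s i).
Proof.
rewrite /UP; apply: (big_ind (fun v => exists s : 'S_N, v = \sum_i A i (s i))).
- by exists 1%g; apply: eq_bigr => i _; rewrite perm1.
- by move=> x y Px Py; rewrite maxEle; case: ifP.
- by move=> s _; exists s.
Qed.

Lemma eq_UP (R : realDomainType) (N : nat) (A B : 'I_N -> 'I_N -> R) :
  A =2 B -> UP A = UP B.
Proof. by move=> AB; congr UP; apply/boolp.funext => i; apply/boolp.funext => j. Qed.

Lemma UP_row_perm (R : realDomainType) (N : nat) (A : 'I_N -> 'I_N -> R) (t : 'S_N) :
  UP (fun i => A (t i)) = UP A.
Proof.
apply/eqP; rewrite eq_le; apply/andP; split.
  have [s ->] := UP_attained (fun i => A (t i)).
  rewrite (le_trans _ (UP_ge _ (t^-1 * s)%g)) //.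
  rewrite [X in _ <= X](reindex_inj (@perm_inj _ t)) /=.
  by under [X in _ <= X]eq_bigr do rewrite permM permK.
have [s ->] := UP_attained A.
rewrite (le_trans _ (UP_ge _ (t * s)%g)) // (reindex_inj (@perm_inj _ t)) /=.
by under [X in _ <= X]eq_bigr do rewrite permM.
Qed.

Lemma UP_add_row (R : realDomainType) (N : nat) (A : 'I_N -> 'I_N -> R)
    (x : 'I_N -> R) :
  UP (fun i j => x i + A i j) = \sum_i x i + UP A.
Proof.
apply/eqP; rewrite eq_le; apply/andP; split.
  have [s ->] := UP_attained (fun i j => x i + A i j).
  by rewrite big_split lerD2l UP_ge.
have [s ->] := UP_attained A.
by rewrite -big_split (UP_ge (fun i j => x i + A i j)).
Qed.

Lemma sum_ltn_pairs (V : nmodType) (N : nat) (F : 'I_N -> 'I_N -> V) :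
  (forall i, F i i = 0) ->
  \sum_i \sum_j F i j = \sum_(j < N) \sum_(i < N | (i < j)%N) (F i j + F j i).
Proof.
move=> F0; under [RHS]eq_bigr do rewrite big_split.
rewrite big_split /= [X in _ = X + _](exchange_big_dep xpredT) //= -big_split.
apply: eq_bigr => i _ /=; rewrite [X in X + _]big_mkcond [X in _ + X]big_mkcond.
rewrite -big_split; apply: eq_bigr => j _ /=.
by have [ij|ji|/val_inj ->] := ltngtP i j; rewrite ?ltnn ?F0 ?addr0 ?add0r.
Qed.

(** Since [s i] counts the j with s j < s i, each unordered pair contributes exactly one of [q i],
    [q j], hence at most their maximum. *)
Lemma sum_perm_weight_le (R : realDomainType) (N : nat) (q : 'I_N -> R) (s : 'S_N) :
  \sum_i q i * (s i)%:R <=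
  \sum_(j < N) \sum_(i < N | (i < j)%N) Num.max (q i) (q j).
Proof.
have val_count (i : 'I_N) : (s i)%:R = \sum_j (s j < s i)%N%:R :> R.
  transitivity (\sum_(k < N) (k < s i)%N%:R : R); last exact/reindex_inj/perm_inj.
  under eq_bigr do rewrite mulrb.
  by rewrite -big_mkcond -(big_ord_widen _ (fun=> 1)) ?sumr_const ?card_ord // ltnW.
under eq_bigr do rewrite val_count mulr_sumr.
rewrite sum_ltn_pairs => [|i]; last by rewrite ltnn mulr0.
apply: ler_sum => j _; apply: ler_sum => i ij.
have [sij|sji|/val_inj /perm_inj ij'] := ltngtP (s i) (s j);
  rewrite ?mulr1 ?mulr0 ?addr0 ?add0r.
- by rewrite le_max lexx orbT.
- by rewrite le_max lexx.
- by rewrite ij' ltnn in ij.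
Qed.

(** * Positive soliton sums and their growth *)

Section Soliton.
Variables (R : realType) (N : nat) (p : 'I_N -> R).
Hypothesis p_ge0 : forall i, 0 <= p i.
Hypothesis p_homo : {homo p : i j / (i <= j)%N >-> i <= j}.

Definition signed (b : bool) (x : R) : R := if b then x else - x.

(* The coefficients i + 2 and 1 / (i + 2) keep all bases apart even when some
   p i vanish or coincide. *)
Definition coef (i : 'I_N) (b : bool) : R := if b then i.+2%:R else i.+2%:R^-1.

(** The two values of [b] give Q_i and 1 / Q_i. *)
Definition base (i : 'I_N) (b : bool) (n : nat) : R :=
  coef i b * expR (n%:R * signed b (p i)).

Lemma coef_gt0 i b : 0 < coef i b.
Proof. by case: b; rewrite /coef ?invr_gt0 ltr0n. Qed.

Lemma growth_base i b : growth (base i b) (signed b (p i)).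
Proof. exact/growth_scale/coef_gt0. Qed.

Lemma base_ge0 i b n : 0 <= base i b n.
Proof. exact/ltW/growth_gt0/growth_base. Qed.

(** For i < j, Q_j exceeds both Q_i and 1 / Q_i, while 1 / Q_j lies below both. So the sign depends
    on [b'] alone, and the strict order of the coefficients excludes cancellation when exponents
    agree. *)
Lemma growth_base_sub (i j : 'I_N) (b b' : bool) : (i < j)%N ->
  growth (fun n => (-1) ^+ (~~ b') * (base j b' n - base i b n))
         (Num.max (signed b (p i)) (signed b' (p j))).
Proof.
move=> ij; have pij := p_homo (ltnW ij).
have coef_le1 k : coef k false <= 1 by rewrite invf_le1 ?ltr0n // ler1n.
have coef_lt k : coef k false < coef k true.
  by rewrite (le_lt_trans (coef_le1 k)) // ltr1n.
have coefij : coef i true < coef j true by rewrite ltr_nat.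
have [pi pj] := (p_ge0 i, p_ge0 j).
case: b' => /=.
  have lij : signed b (p i) <= p j by case: (b) => /=; lra.
  rewrite max_r //; apply: eq_growth (growth_sub (ltW (coef_gt0 i b)) _ lij).
    by move=> n; rewrite mul1r.
  by case: (b) => //; apply: lt_trans coefij.
have lij : - p j <= signed b (p i) by case: (b) => /=; lra.
rewrite max_l //; apply: eq_growth (growth_sub (ltW (coef_gt0 j false)) _ lij).
  by move=> n; rewrite expr1 mulN1r opprB.
have jifalse : coef j false < coef i false by rewrite ltf_pV2 ?posrE ?ltr0n // ltr_nat.
by case: (b) => //; apply: lt_trans (coef_lt i).
Qed.

(** The absolute value of the Vandermonde determinant of the bases selected by [e]. *)
Definition vand (e : {ffun 'I_N -> bool}) (n : nat) : R :=
  \prod_(j < N) \prod_(i < N | (i < j)%N)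
    ((-1) ^+ (~~ e j) * (base j (e j) n - base i (e i) n)).

Lemma growth_vand e : growth (vand e)
  (\sum_(j < N) \sum_(i < N | (i < j)%N)
     Num.max (signed (e i) (p i)) (signed (e j) (p j))).
Proof.
by apply: growth_prod => j _; apply: growth_prod => i ij; apply: growth_base_sub.
Qed.

(** Triangle inequality in the Leibniz formula. *)
Lemma vand_le e n : vand e n <= \sum_(s : 'S_N) \prod_i base i (e i) n ^+ s i.
Proof.
rewrite -[vand e n]gtr0_norm ?(growth_gt0 n (growth_vand e)) //.
have -> : `|vand e n| = `|\det (Vandermonde N (\row_i base i (e i) n))|.
  rewrite det_Vandermonde (exchange_big_dep xpredT) //= !normr_prod.
  apply: eq_bigr => j _; rewrite !normr_prod; apply: eq_bigr => i _.
  by rewrite normrMsign !mxE.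
rewrite -det_tr (le_trans (ler_norm_sum _ _ _)) // ler_sum // => s _.
rewrite normrMsign normr_prod; apply: ler_prod => i _.
by rewrite normr_ge0 !mxE normrX ger0_norm ?base_ge0 ?lexx.
Qed.

(** The entry (i, j) is the rate of the sum over b of W i b * base i b ^ j when [W i b] has rate
    [w i b]. *)
Definition tropical (w : 'I_N -> bool -> R) : R :=
  UP (fun i j : 'I_N => Num.max (w i true + p i * j%:R) (w i false - p i * j%:R)).

Definition soliton_sum (W : 'I_N -> bool -> nat -> R) (n : nat) : R :=
  \sum_(e : {ffun 'I_N -> bool}) (\prod_i W i (e i) n) * vand e n.

(* The rate of [vand] is a sum over pairs; [vand_le] and [sum_perm_weight_le]
   bound it above and below by the permanent-like maximum over permutations. *)
Lemma growth_soliton_sum W w : (forall i b, growth (W i b) (w i b)) ->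
  growth (soliton_sum W) (tropical w).
Proof.
move=> Ww; have W0 i b n := ltW (growth_gt0 n (Ww i b)).
have vand0 e n := ltW (growth_gt0 n (growth_vand e)).
have term_growth (e : {ffun 'I_N -> bool}) := growth_mul
  (growth_prod (index_enum 'I_N) (P := xpredT) (fun i _ => Ww i (e i)))
  (growth_vand e).
split.
  apply: dominated_sum => [n|e]; first exact: expR_ge0.
  apply: (@dominated_trans _ _ (fun n => \sum_(s : 'S_N)
      \prod_i (W i (e i) n * base i (e i) n ^+ s i))).
    apply: le_dominated => n.
    under [X in _ <= X]eq_bigr do rewrite big_split.
    by rewrite -mulr_sumr ler_wpM2l ?vand_le // prodr_ge0.
  apply: dominated_sum => [n|s]; first exact: expR_ge0.
  have gX i : growth (fun n => base i (e i) n ^+ s i) (signed (e i) (p i) * (s i)%:R).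
    rewrite mulr_natr -[s i : nat]card_ord -sumr_const.
    apply: eq_growth (growth_prod _ (fun _ _ => growth_base i (e i))) => n.
    by rewrite prodr_const.
  have [up _] := growth_prod (index_enum 'I_N) (P := xpredT)
    (fun i _ => growth_mul (Ww i (e i)) (gX i)).
  apply: dominated_trans up (dominated_expR _).
  apply: le_trans (UP_ge _ s); apply: ler_sum => i _; rewrite le_max.
  by case: (e i); rewrite /signed ?mulNr lexx ?orbT.
have [s UPs] := UP_attained (fun i j : 'I_N =>
  Num.max (w i true + p i * j%:R) (w i false - p i * j%:R)).
(* In each row [e] picks the branch attaining the maximum along the optimal [s]; the single term of
   [e] already grows fast enough. *)
pose e := [ffun i => w i false - p i * (s i)%:R <= w i true + p i * (s i)%:R].
have [_ low] := term_growth e.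
apply: dominated_trans (dominated_trans low _).
  apply: dominated_expR; rewrite /tropical UPs.
  apply: le_trans (_ : \sum_i (w i (e i) + signed (e i) (p i) * (s i)%:R) <= _).
    apply: ler_sum => i _; rewrite /signed ffunE maxC maxEle.
    by case: ifP => _; rewrite ?mulNr.
  by rewrite big_split lerD2l sum_perm_weight_le.
apply: le_dominated => n; rewrite /soliton_sum (bigD1 e) //= lerDl.
by apply: sumr_ge0 => f _; apply: mulr_ge0 => //; apply: prodr_ge0.
Qed.

(** The sign of row j occurs once for each i < j, hence j times. *)
Lemma vandE e n : vand e n = (\prod_(j < N) ((-1) ^+ (~~ e j)) ^+ j) *
  \prod_(j < N) \prod_(i < N | (i < j)%N) (base j (e j) n - base i (e i) n).
Proof.
rewrite -big_split; apply: eq_bigr => j _ /=; rewrite big_split; congr (_ * _).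
by rewrite -(big_ord_widen _ (fun=> _)) ?prodr_const ?card_ord // ltnW.
Qed.

Variables (beta : 'I_N -> bool -> R) (a : 'I_4 -> R).

(* The factor 4 - k separates nodes with equal exponents. *)
Definition node (k : 'I_4) (n : nat) : R := (4 - k)%:R * expR (n%:R * a k).

(** With 0-based i, the sign exponent i is the number of smaller indices, as in [vandE]. *)
Definition casorati (n : nat) : 'M[R]_(N, N + 2) :=
  \matrix_(i, j) \sum_b ((-1) ^+ (~~ b)) ^+ i * expR (n%:R * beta i b) *
                        base i b n ^+ j.

(** The last two factors pair row i with the two extra nodes; these enter negated, so positive sums
    replace differences. *)
Definition node_weight (k l : 'I_4) (i : 'I_N) (b : bool) (n : nat) : R :=
  expR (n%:R * beta i b) * ((node k n + base i b n) * (node l n + base i b n)).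

Definition pair_tropical (k l : 'I_4) : R :=
  tropical (fun i b => beta i b + (Num.max (a k) (signed b (p i)) +
                                   Num.max (a l) (signed b (p i)))).

(* The alternating signs in [casorati] make every Vandermonde term of the
   expansion positive. *)
Lemma det_casorati k l n :
  \det (col_mx (casorati n) (col_mx (pow_row (N + 2) (- node k n))
                                    (pow_row (N + 2) (- node l n)) : 'M_(2, N + 2))) =
  (node k n - node l n) * soliton_sum (node_weight k l) n.
Proof.
rewrite det_sum_rows /soliton_sum mulr_sumr; apply: eq_bigr => e _.
rewrite (det_powers (fun i => base i (e i) n)) vandE !big_split /=.
have eqN x y : \prod_(i < N) (- x - base i (e i) n) *
      \prod_(i < N) (- y - base i (e i) n) =
    \prod_(i < N) (x + base i (e i) n) * \prod_(i < N) (y + base i (e i) n).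
  by rewrite -!big_split; apply: eq_bigr => i _ /=; ring.
rewrite eqN opprK [- node l n + _]addrC.
move: (node k n - _) => d; move: (\prod_(i < N) _ ^+ i) (\prod_(i < N) expR _).
move: (\prod_(j < N) \prod_(i < N | _) _) (\prod_(i < N) _) (\prod_(i < N) _).
by move=> V X Y A B; ring.
Qed.

Lemma growth_node k : growth (node k) (a k).
Proof. by apply: growth_scale; rewrite ltr0n subn_gt0. Qed.

Lemma growth_node_weight k l i b : growth (node_weight k l i b)
  (beta i b + (Num.max (a k) (signed b (p i)) + Num.max (a l) (signed b (p i)))).
Proof.
apply: growth_mul.
  by apply: eq_growth (growth_scale _ ltr01) => n; rewrite mul1r.
by apply: growth_mul; apply: growth_add (growth_node _) (growth_base _ _).
Qed.

Hypothesis a_homo : {homo a : k l / (k <= l)%N >-> l <= k}.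

Lemma growth_node_sub (k l : 'I_4) : (k < l)%N ->
  growth (fun n => node k n - node l n) (a k).
Proof.
move=> kl; apply: growth_sub; rewrite ?ler0n ?a_homo ?(ltnW kl) //.
by rewrite ltr_nat ltn_sub2l // (leq_trans kl) // ltnW.
Qed.

Lemma tropical_plucker :
  Num.max (a 0 + pair_tropical 0 1 + (a 2 + pair_tropical 2 3))
          (a 0 + pair_tropical 0 3 + (a 1 + pair_tropical 1 2)) =
  a 0 + pair_tropical 0 2 + (a 1 + pair_tropical 1 3).
Proof.
pose E k l n := (node k n - node l n) * soliton_sum (node_weight k l) n.
have gE (k l : 'I_4) : (k < l)%N -> growth (E k l) (a k + pair_tropical k l).
  move=> kl; apply: growth_mul (growth_node_sub kl) _.
  exact/growth_soliton_sum/growth_node_weight.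
(* Both sides are rates of E_02 E_13, which the Plücker relation equates with E_01 E_23 + E_03
   E_12. *)
apply: growth_inj (growth_mul (gE 0 2 isT) (gE 1 3 isT)).
apply: eq_growth (growth_add (growth_mul (gE 0 1 isT) (gE 2 3 isT))
                             (growth_mul (gE 0 3 isT) (gE 1 2 isT))) => n.
have := det_plucker (casorati n) (fun k => pow_row (N + 2) (- node k n)).
rewrite /= !det_casorati -/(E _ _ n) => pl.
by apply/eqP; rewrite -subr_eq0 -{}pl; apply/eqP; rewrite /E; ring.
Qed.

End Soliton.

(** * Reduction to sorted nonnegative p *)

Lemma perm_sorted (R : realDomainType) (N : nat) (p : 'I_N -> R) :
  exists t : 'S_N, {homo (p \o t) : i j / (i <= j)%N >-> i <= j}.
Proof.
pose u := [tuple p i | i < N]; pose v := sort <=%R u.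
have uv : perm_eq v u by rewrite perm_sort.
have [t vE] := tuple_permP uv.
exists t => i j ij; have sz : size v = N by rewrite size_sort size_tuple.
have vn (k : 'I_N) : nth 0 v k = p (t k) by rewrite vE -tnth_nth !tnth_mktuple.
rewrite /= -!vn; apply: (sorted_leq_nth (@le_trans _ R) (@lexx _ R)) => //.
- by apply: sort_sorted; apply: le_total.
- by rewrite inE sz.
- by rewrite inE sz.
Qed.

Lemma tau_perm (R : realDomainType) (N : nat) (a1 a2 a3 : R) (p c c' : 'I_N -> R)
    (s l m n : int) (t : 'S_N) :
  tau a1 a2 a3 (p \o t) (c \o t) (c' \o t) s l m n = tau a1 a2 a3 p c c' s l m n.
Proof.
exact: (UP_row_perm (fun i j =>
  phi a1 a2 a3 (p i) (c i) (c' i) l m n (s + (j : nat)%:Z))).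
Qed.

(* [Defs.eta], since plain [eta] is shadowed by HB.structures. *)
Lemma phi_opp (R : realDomainType) (a1 a2 a3 p c c' : R) (l m n s : int) :
  phi a1 a2 a3 (- p) c' c l m n s = phi a1 a2 a3 p c c' l m n s.
Proof. by rewrite /phi /Defs.eta /eta' !opprK maxC. Qed.

(** Changing the sign of p exchanges the two branches of [phi], so [c] and [c'] are swapped exactly
    in the rows with negative p. *)
Lemma tau_norm (R : realDomainType) (N : nat) (a1 a2 a3 : R) (p c c' : 'I_N -> R)
    (s l m n : int) :
  tau a1 a2 a3 (fun i => `|p i|) (fun i => if 0 <= p i then c i else c' i)
    (fun i => if 0 <= p i then c' i else c i) s l m n =
  tau a1 a2 a3 p c c' s l m n.
Proof.
apply: eq_UP => i j; case: ger0P => // _; exact: phi_opp.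
Qed.

(** * The KP equation for sorted data *)

Section SortedKP.
Variables (R : realType) (N : nat) (a1 a2 a3 : R) (p c c' : 'I_N -> R) (s : int).
Hypotheses (h12 : a2 < a1) (h23 : a3 < a2).
Hypothesis p_ge0 : forall i, 0 <= p i.
Hypothesis p_homo : {homo p : i j / (i <= j)%N >-> i <= j}.

(** The shift [s] is absorbed into [w], leaving the column shift j to [tropical]; the row constant
    [x] comes out of the permanent. *)
Lemma tropical_tau (w : 'I_N -> bool -> R) (x : R) (l m n : int) :
  (forall i, w i true = x + Defs.eta a1 a2 a3 (p i) (c i) l m n s) ->
  (forall i, w i false = x + eta' a1 a2 a3 (p i) (c' i) l m n s) ->
  tropical p w = \sum_(i < N) x + tau a1 a2 a3 p c c' s l m n.
Proof.
move=> wt wf; rewrite -UP_add_row; apply: eq_UP => i j.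
rewrite wt wf /phi addr_maxr /Defs.eta /eta' !intrD -!pmulrn.
by congr Num.max; ring.
Qed.

Lemma tau_kp_sorted (l m n : int) :
  tau a1 a2 a3 p c c' s l (m + 1) n + tau a1 a2 a3 p c c' s (l + 1) m (n + 1) - a2 =
  Num.max (tau a1 a2 a3 p c c' s (l + 1) m n + tau a1 a2 a3 p c c' s l (m + 1) (n + 1) - a1)
          (tau a1 a2 a3 p c c' s l m (n + 1) + tau a1 a2 a3 p c c' s (l + 1) (m + 1) n - a2).
Proof.
(* A fourth node a0 above all exponents enters only through the constant N * a0,
   so that pairing it with a node k yields the tau function shifted by k alone. *)
pose a0 := Num.max a1 (\sum_i p i).
have a01 : a1 <= a0 by rewrite le_max lexx.
have [a21 a32] := (ltW h12, ltW h23); have a31 := le_trans a32 a21.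
have a02 := le_trans a21 a01; have a03 := le_trans a31 a01.
have a0p i : p i <= a0.
  by rewrite le_max (bigD1 i) //= lerDl sumr_ge0 ?orbT.
pose a (k : 'I_4) := nth 0 [:: a0; a1; a2; a3] k.
pose beta i (b : bool) := if b then Defs.eta a1 a2 a3 (p i) (c i) l m n s
                          else eta' a1 a2 a3 (p i) (c' i) l m n s.
have a_homo : {homo a : k l / (k <= l)%N >-> l <= k}.
  by move=> [[|[|[|[|//]]]] ?] [[|[|[|[|//]]]] ?].
have max0 b i : Num.max (a 0) (signed b (p i)) = a0.
  by apply/max_l; move: (p_ge0 i) (a0p i); case: b; rewrite /a /=; lra.
(* Splits max(a_k, ±p_i) into the row constant a_k and the increment of [eta] or [eta'] under a unit
   shift in direction k. *)
have maxa x y : Num.max x y = x + Num.max 0 (y - x) :> R.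
  by rewrite addr_maxr addr0 addrC subrK.
have T01 : pair_tropical p beta a 0 1 =
    \sum_(i < N) (a0 + a1) + tau a1 a2 a3 p c c' s (l + 1) m n.
  by apply: tropical_tau => i;
    rewrite max0 (maxa (a _)) /beta /Defs.eta /eta' !intrD /a /=; ring.
have T02 : pair_tropical p beta a 0 2 =
    \sum_(i < N) (a0 + a2) + tau a1 a2 a3 p c c' s l (m + 1) n.
  by apply: tropical_tau => i;
    rewrite max0 (maxa (a _)) /beta /Defs.eta /eta' !intrD /a /=; ring.
have T03 : pair_tropical p beta a 0 3 =
    \sum_(i < N) (a0 + a3) + tau a1 a2 a3 p c c' s l m (n + 1).
  by apply: tropical_tau => i;
    rewrite max0 (maxa (a _)) /beta /Defs.eta /eta' !intrD /a /=; ring.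
have T12 : pair_tropical p beta a 1 2 =
    \sum_(i < N) (a1 + a2) + tau a1 a2 a3 p c c' s (l + 1) (m + 1) n.
  by apply: tropical_tau => i;
    rewrite !(maxa (a _)) /beta /Defs.eta /eta' !intrD /a /=; ring.
have T13 : pair_tropical p beta a 1 3 =
    \sum_(i < N) (a1 + a3) + tau a1 a2 a3 p c c' s (l + 1) m (n + 1).
  by apply: tropical_tau => i;
    rewrite !(maxa (a _)) /beta /Defs.eta /eta' !intrD /a /=; ring.
have T23 : pair_tropical p beta a 2 3 =
    \sum_(i < N) (a2 + a3) + tau a1 a2 a3 p c c' s l (m + 1) (n + 1).
  by apply: tropical_tau => i;
    rewrite !(maxa (a _)) /beta /Defs.eta /eta' !intrD /a /=; ring.
have := tropical_plucker p_ge0 p_homo beta a_homo.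
(* All three products carry the constant N (a0 + a1 + a2 + a3); removing it and a0 + a1 + a2 leaves
   the claim. *)
rewrite T01 T02 T03 T12 T13 T23 !big_split /a /=.
by rewrite !maxEle; do 2 case: ifPn; rewrite -?ltNge; lra.
Qed.

End SortedKP.

Theorem theorem2 (R : realType) (N : nat) (hN : (1 <= N)%N) (a1 a2 a3 : R)
    (h12 : a2 < a1) (h23 : a3 < a2) (p c c' : 'I_N -> R) (s : int) :
  forall l m n : int,
    tau a1 a2 a3 p c c' s l (m + 1) n + tau a1 a2 a3 p c c' s (l + 1) m (n + 1) - a2 =
    Num.max (tau a1 a2 a3 p c c' s (l + 1) m n + tau a1 a2 a3 p c c' s l (m + 1) (n + 1) - a1)
            (tau a1 a2 a3 p c c' s l m (n + 1) + tau a1 a2 a3 p c c' s (l + 1) (m + 1) n - a2).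
Proof.
move=> l m n.
pose q i := `|p i|; have [t qt] := perm_sorted q.
(* The normalised data do not depend on the lattice point, so they serve all six values of tau. *)
have tauE x y z := etrans (tau_perm a1 a2 a3 q _ _ s x y z t)
  (tau_norm a1 a2 a3 p c c' s x y z).
rewrite -!tauE; apply: tau_kp_sorted => // i; exact: normr_ge0.
Qed.
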